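(* Let $q=p^\alpha$ with $p$ prime, let $(1,0,H)\in\mathcal S$ (that is, $H$ is an $\mathbb F_p$-subspace of $\mathbb F_q$) and let $|H|=p^\beta$. Then for every integer $0\le k\le q$, $$\begin{aligned} \mathcal N(S(1,0,H),k)=\;&(1-p^{\alpha-\beta})\sum_{0\le l\le \alpha-\beta}(-1)^l\,p^{\binom l2}{\alpha-\beta \brack l}_p\, s_{q,k}(1,p^{\beta+l})\\ &+p^{\alpha-\beta}\sum_{P\subset\mathcal P(|H'|-1)}\ \sum_{0\le l\le(\alpha-\beta)/o_{\Pi P}(p)}(-1)^{|P|+l}\,p^{o_{\Pi P}(p)\binom l2}{(\alpha-\beta)/o_{\Pi P}(p)\brack l}_{p^{o_{\Pi P}(p)}}\, s_{q,k}\bigl(\Pi P,\,p^{\beta+l\,o_{\Pi P}(p)}\bigr). \end{aligned}$$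
   Context: $\mathbb F_q$ is the field with $q=p^\alpha$ elements, $p$ prime. $\mathrm{AGL}(1,\mathbb F_q)=\left\{\left[\begin{smallmatrix}a&b\\0&1\end{smallmatrix}\right]:a\in\mathbb F_q^*,\ b\in\mathbb F_q\right\}$ acts on $\mathbb F_q$ by $\left[\begin{smallmatrix}a&b\\0&1\end{smallmatrix}\right]x=ax+b$. For $B\subset\mathbb F_q$, $\mathrm{AGL}(1,\mathbb F_q)_B=\{\sigma:\sigma(B)=B\}$ is the (setwise) stabilizer. $\mathcal S$ is the set of triples $(a,b,H)$ with $a\in\mathbb F_q^*$, $H$ an $\mathbb F_p(a)$-subspace of $\mathbb F_q$, and $b=0$ if $a=1$, $b\in\mathbb F_q$ if $a\ne1$. Let $\overline H=\left\{\left[\begin{smallmatrix}1&h\\0&1\end{smallmatrix}\right]:h\in H\right\}$ and let $S(a,b,H)$ be the subgroup of $\mathrm{AGL}(1,\mathbb F_q)$ generated by $\left[\begin{smallmatrix}a&b\\0&1\end{smallmatrix}\right]$ and $\overline H$. For a subgroup $S$ of $\mathrm{AGL}(1,\mathbb F_q)$, $\mathcal N(S,k)$ is the number of subsets $B\subset\mathbb F_q$ with $|B|=k$ and $\mathrm{AGL}(1,\mathbb F_q)_B=S$. $H'=\{x\in\mathbb F_q:xH\subset H\}$, a subfield of $\mathbb F_q$ (the largest subfield $K$ such that $H$ is a $K$-module). For a positive integer $u$, $\mathcal P(u)$ is the set of prime divisors of $u$; $o_u(v)$ is the multiplicative order of $v$ modulo $u$ when $\gcd(u,v)=1$ (so $o_1(v)=1$).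 For a finite set $P$ of integers, $\Pi P=\prod_{e\in P}e$ (so $\Pi\emptyset=1$). ${n\brack m}_Q=\prod_{i=0}^{m-1}\frac{1-Q^{n-i}}{1-Q^{i+1}}$ is the Gaussian binomial coefficient. For integers $u,v>0$, $s_{q,k}(u,v)=\binom{(q-v)/uv}{k/uv}+\binom{(q-v)/uv}{(k-v)/uv}$, where $\binom xy:=0$ if $y$ is not a nonnegative integer. *)

(* Defs.v *)
From HB Require Import structures.
From mathcomp Require Import all_boot all_order all_fingroup all_algebra.
From mathcomp Require Import cyclic.

Set Implicit Arguments.
Unset Strict Implicit.
Unset Printing Implicit Defensive.

Import Order.TTheory GRing.Theory Num.Theory.

Local Open Scope ring_scope.

Section AffineGroup.

Variable F : finFieldType.

Implicit Types (a b x : F) (H K B : {set F}) (g : {'GL_2[F]}).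

Definition aff_mx a b : 'M[F]_2 :=
  \matrix_(i, j) if i == 0 then (if j == 0 then a else b) else (j == 1)%:R.

Definition AGL1 : {set {'GL_2[F]}} :=
  [set g | [exists a, exists b, (a != 0) && (val g == aff_mx a b)]].

Definition aff_act g x : F := val g 0 0 * x + val g 0 1.

Definition AGL1_stab B : {set {'GL_2[F]}} :=
  [set g in AGL1 | aff_act g @: B == B].

Definition is_subfield K : bool :=
  [&& 1 \in K, [forall x in K, forall y in K, x - y \in K]
    & [forall x in K, forall y in K, x / y \in K]].

(* As the smallest subfield containing a, this is F_p(a), p being the
   characteristic of F. *)
Definition Fp_adjoin a : {set F} :=
  \bigcap_(K : {set F} | is_subfield K && (a \in K)) K.

Definition is_subspace K H : bool :=
  [&& 0 \in H, [forall x in H, forall y in H, x + y \in H]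
    & [forall c in K, forall x in H, c * x \in H]].

Definition calS : {set F * F * {set F}} :=
  [set t | let: (a, b, H) := t in
     [&& a != 0, is_subspace (Fp_adjoin a) H & (a == 1) ==> (b == 0)]].

Definition Hbar H : {set {'GL_2[F]}} :=
  [set g | [exists h in H, val g == aff_mx 1 h]].

(* For a != 0 the first set is the singleton of the matrix aff_mx a b. *)
Definition S_group a b H : {group {'GL_2[F]}} :=
  <<[set g : {'GL_2[F]} | val g == aff_mx a b] :|: Hbar H>>%G.

Definition numN (S : {group {'GL_2[F]}}) (k : nat) : nat :=
  #|[set B : {set F} | (#|B| == k) && (AGL1_stab B == S)]|.

Definition Hprime H : {set F} := [set x | [forall h in H, x * h \in H]].

End AffineGroup.

Definition prime_divs (u : nat) : {set 'I_u.+1} :=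
  [set e : 'I_u.+1 | prime e && (e %| u)%N].

Definition PiP (n : nat) (P : {set 'I_n}) : nat := (\prod_(e in P) e)%N.

Lemma mulord_ex (u v : nat) :
  exists m, (0 < m)%N && (coprime u v ==> (v ^ m == 1 %[mod u])%N).
Proof.
case: (posnP u) => [->|u0].
  by exists 1%N; rewrite /coprime gcd0n expn1; apply/implyP => /eqP ->.
exists (totient u); rewrite totient_gt0 u0 /=; apply/implyP => uv.
by apply/eqP/Euler_exp_totient; rewrite coprime_sym.
Qed.

(* The multiplicative order of v modulo u when u and v are coprime; the junk
   value is 1 otherwise. *)
Definition mulord (u v : nat) : nat := ex_minn (mulord_ex u v).

(* For m > n the product vanishes, by the factor at i = n. *)
Definition gauss_binom (n m : nat) (Q : rat) : rat :=
  \prod_(i < m) ((1 - Q ^+ (n - i)) / (1 - Q ^+ i.+1)).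

Definition binom_rat (x y : rat) : rat :=
  if y \is a Num.nat then \prod_(i < Num.truncn y) ((x - i%:R) / i.+1%:R)
  else 0.

Definition s_qk (q k u v : nat) : rat :=
  binom_rat ((q%:R - v%:R) / (u * v)%:R) (k%:R / (u * v)%:R) +
  binom_rat ((q%:R - v%:R) / (u * v)%:R) ((k%:R - v%:R) / (u * v)%:R).

(* Main.v *)
Require Import Defs.
From mathcomp Require Import all_boot all_order all_fingroup all_algebra.
From mathcomp Require Import cyclic finfield ring.

(** A subgroup of the affine group whose translations are those by [H], and which
    contains other maps, contains some nontrivial dilation [x |-> a * x + b],
    [a != 1], and every dilation fixes a unique point, its centre. So the sets
    [B] with stabilizer [Hbar H] are the sets with translation group exactly [H]
    that are preserved by no nontrivial dilation.

    Fix the cardinal [k]. Let [X] be the family of the sets [B] with translation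
    group exactly [H], [Y] the family of those preserved by some nontrivial
    dilation, and [Z] the family of those preserved by some nontrivial dilation
    about [0]. The commutator of two dilations is a translation by a multiple
    of the difference of their centres, so for each [B] in [Y] the centres of the
    dilations preserving [B] form one coset of [H] (dilation_stable_transl).
    Translations identify the sets attached to a centre [c] with those attached
    to [0]; counting the pairs of a set and a centre gives
    [#|Y| * #|H| = #|F| * #|Z|] (card_dilation_stable), that is,
    [#|Y| = p ^ (alpha - beta) * #|Z|]. The number to be computed is then
    [#|X| - #|Y| = (1 - p ^ (alpha - beta)) * #|X|
                    + p ^ (alpha - beta) * (#|X| - #|Z|)],
    which explains the two parts of the formula.

    The ratio of a dilation preserving [B] maps [H] to itself, hence lies in the
    field [Hprime H]. Its nonzero elements form a cyclic group, and [B] is outside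
    [Z] when no ratio of prime order preserves it; inclusion-exclusion over the
    sets [P] of prime divisors of [#|Hprime H| - 1] reduces [#|X| - #|Z|] to the
    numbers of sets in [X] preserved by a given ratio [a] of order [u], the
    product of the elements of [P] (no_dilation_sum). The case [u = 1] is [#|X|].

    To find these numbers (card_exact_transl), let [K] be the field generated by
    [a], which has [p ^ o] elements, [o] being the order of [p] modulo [u]
    (card_Fp_adjoin). The translation group of a set preserved by [a] is a
    [K]-space, so Moebius inversion over the [K]-spaces [W] containing [H] applies
    (card_intermediate, subspace_moebius). The number of sets invariant under [a]
    and [W] is [s_qk] (card_invariant): the orbits of the group they generate are
    [W] itself and free orbits with [u * #|W|] elements. *)

Set Implicit Arguments.
Unset Strict Implicit.
Unset Printing Implicit Defensive.

Import Order.TTheory GRing.Theory Num.Theory.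

Local Open Scope ring_scope.

(** * Gaussian binomial coefficients *)

Section GaussBinomial.

Variable Q : rat.
Hypothesis Q_gt1 : 1 < Q.

Lemma subr1X_neq0 n : 1 - Q ^+ n.+1 != 0.
Proof. by rewrite subr_eq0 eq_sym gt_eqF // exprn_egt1. Qed.

Lemma gauss_binom0 n : gauss_binom n 0 Q = 1.
Proof. by rewrite /gauss_binom big_ord0. Qed.

Lemma gauss_binomSr n l :
  gauss_binom n l.+1 Q =
    gauss_binom n l Q * ((1 - Q ^+ (n - l)) / (1 - Q ^+ l.+1)).
Proof. by rewrite /gauss_binom big_ord_recr. Qed.

Lemma gauss_binom_small n l : (n < l)%N -> gauss_binom n l Q = 0.
Proof.
move=> ltnl; rewrite /gauss_binom (bigD1 (Ordinal ltnl)) //= subnn expr0.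
by rewrite subrr !mul0r.
Qed.

Lemma gauss_binomSS n l :
  gauss_binom n.+1 l.+1 Q =
    (1 - Q ^+ n.+1) / (1 - Q ^+ l.+1) * gauss_binom n l Q.
Proof.
rewrite /gauss_binom !prodf_div big_ord_recl subn0.
rewrite [X in _ / X]big_ord_recr /= invfM.
under eq_bigr do rewrite /bump add1n subSS.
by rewrite [_^-1 * _]mulrC mulrACA.
Qed.

Lemma gauss_binom_pascal n l :
  gauss_binom n.+1 l.+1 Q =
    gauss_binom n l Q + Q ^+ l.+1 * gauss_binom n l.+1 Q.
Proof.
have [lenl|ltnl] := leqP l n; last first.
  by rewrite !gauss_binom_small ?mulr0 ?addr0 // ltnW.
rewrite gauss_binomSS gauss_binomSr.
have -> : Q ^+ n.+1 = Q ^+ l.+1 * Q ^+ (n - l) by rewrite -exprD addSn subnKC.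
by have := subr1X_neq0 l; move: (gauss_binom _ _ _) (Q ^+ _) (Q ^+ _) => ? ? ? ?; field.
Qed.

(** With Pascal's rule the alternating sum telescopes. *)
Lemma sum_gauss_binom_trunc m L :
  \sum_(0 <= l < L.+1) (-1) ^+ l * Q ^+ 'C(l, 2) * gauss_binom m.+1 l Q =
    (-1) ^+ L * Q ^+ 'C(L.+1, 2) * gauss_binom m L Q.
Proof.
elim: L => [|L IHL]; first by rewrite big_nat1 !gauss_binom0.
rewrite big_nat_recr //= IHL gauss_binom_pascal ['C(L.+2, 2)]binS bin1 exprD !exprS.
by ring.
Qed.

(** This says that [(-1) ^+ l * Q ^+ 'C(l, 2)] is the Moebius function of the
    lattice of subspaces over a field with [Q] elements. Any upper limit [L]
    large enough gives the same sum, so that sums for spaces of different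
    dimensions can be taken over the same range. *)
Lemma sum_gauss_binom m L : (m <= L)%N ->
  \sum_(0 <= l < L.+1) (-1) ^+ l * Q ^+ 'C(l, 2) * gauss_binom m l Q =
    (m == 0)%:R.
Proof.
case: m => [_|m lemL]; last first.
  by rewrite sum_gauss_binom_trunc gauss_binom_small // mulr0.
rewrite big_nat_recl // gauss_binom0 big1 ?addr0 //.
by move=> i _; rewrite gauss_binom_small ?mulr0.
Qed.

End GaussBinomial.

(** * Subfields and subspaces of a finite field *)

Section Subspaces.

Variable F : finFieldType.
Implicit Types (a b c x y : F) (H K W B : {set F}).

Lemma is_subfieldP K :
  reflect [/\ 1 \in K, {in K &, forall x y, x - y \in K}
             & {in K &, forall x y, x / y \in K}] (is_subfield K).
Proof.
apply: (iffP and3P) => -[K1 KB KV]; split=> //.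
- by move=> x y Kx Ky; move/'forall_implyP: KB => /(_ x Kx) /'forall_implyP; apply.
- by move=> x y Kx Ky; move/'forall_implyP: KV => /(_ x Kx) /'forall_implyP; apply.
- by apply/'forall_implyP => x Kx; apply/'forall_implyP => y Ky; apply: KB.
- by apply/'forall_implyP => x Kx; apply/'forall_implyP => y Ky; apply: KV.
Qed.

Lemma is_subspaceP K H :
  reflect [/\ 0 \in H, {in H &, forall x y, x + y \in H}
             & {in K & H, forall c x, c * x \in H}] (is_subspace K H).
Proof.
apply: (iffP and3P) => -[K1 KB KV]; split=> //.
- by move=> x y Kx Ky; move/'forall_implyP: KB => /(_ x Kx) /'forall_implyP; apply.
- by move=> x y Kx Ky; move/'forall_implyP: KV => /(_ x Kx) /'forall_implyP; apply.
- by apply/'forall_implyP => x Kx; apply/'forall_implyP => y Ky; apply: KB.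
- by apply/'forall_implyP => x Kx; apply/'forall_implyP => y Ky; apply: KV.
Qed.

Lemma card_subspace_gt0 K H : is_subspace K H -> (0 < #|H|)%N.
Proof. by case/is_subspaceP=> H0 _ _; apply/card_gt0P; exists 0. Qed.

Lemma full_subspace K : is_subspace K [set: F].
Proof. by apply/is_subspaceP; split=> [|x y _ _|c x _ _]; rewrite inE. Qed.

Section Subfield.

Variable K : {set F}.
Hypothesis K_subfield : is_subfield K.

Lemma subfield1 : 1 \in K. Proof. by case/is_subfieldP: K_subfield. Qed.

Lemma subfieldB : {in K &, forall x y, x - y \in K}.
Proof. by case/is_subfieldP: K_subfield. Qed.

Lemma subfield_div : {in K &, forall x y, x / y \in K}.
Proof. by case/is_subfieldP: K_subfield. Qed.

Lemma subfield0 : 0 \in K.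
Proof. by rewrite -(subrr 1) subfieldB // subfield1. Qed.

Lemma subfieldN : {in K, forall x, - x \in K}.
Proof. by move=> x Kx; rewrite -sub0r subfieldB // subfield0. Qed.

Lemma subfieldD : {in K &, forall x y, x + y \in K}.
Proof. by move=> x y Kx Ky; rewrite -[y]opprK subfieldB // subfieldN. Qed.

Lemma subfieldV : {in K, forall x, x^-1 \in K}.
Proof. by move=> x Kx; rewrite -div1r subfield_div // subfield1. Qed.

Lemma subfieldM : {in K &, forall x y, x * y \in K}.
Proof. by move=> x y Kx Ky; rewrite -[y]invrK subfield_div // subfieldV. Qed.

Lemma subfieldX x n : x \in K -> x ^+ n \in K.
Proof.
by move=> Kx; elim: n => [|n IH]; rewrite ?subfield1 // exprS subfieldM.
Qed.

Lemma card_subfield_gt1 : (1 < #|K|)%N.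
Proof.
rewrite (cardsD1 0) subfield0 (cardsD1 1) !inE oner_eq0 subfield1 /=.
by rewrite addnA.
Qed.

(** Multiplication by [x] permutes the nonzero elements of [K], so their
    product is unchanged when it is multiplied by [x ^+ (#|K| - 1)]. *)
Lemma subfield_expr_card x : x \in K -> x != 0 -> x ^+ (#|K| - 1) = 1.
Proof.
move=> Kx x0; set U := K :\ 0.
have cU : #|U| = (#|K| - 1)%N by rewrite /U (cardsD1 0 K) subfield0 addKn.
pose z := \prod_(y in U) y.
have z0 : z != 0 by apply/prodf_neq0 => y; rewrite !inE => /andP[].
apply: (mulIf z0); rewrite mul1r -cU -prodr_const -big_split /=.
have injx : injective ( *%R x) by apply: mulfI.
have xU : [set x * y | y in U] = U.
  apply/eqP; rewrite eqEcard card_imset // leqnn andbT; apply/subsetP => w.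
  by case/imsetP => y; rewrite !inE => /andP[y0 Ky] ->; rewrite mulf_neq0 // subfieldM.
by rewrite -[z]/(\prod_(y in U) y) -[in RHS]xU big_imset //= => ? ? _ _; apply: injx.
Qed.

Lemma subspaceB H : is_subspace K H -> {in H &, forall x y, x - y \in H}.
Proof.
case/is_subspaceP => H0 HD HZ x y Hx Hy; rewrite -mulN1r HD // HZ //.
by rewrite subfieldN // subfield1.
Qed.

Definition adjoin_line H x : {set F} := [set h + c * x | h in H, c in K].

Section AdjoinLine.

Variables (H : {set F}) (x : F).
Hypothesis H_subspace : is_subspace K H.

Lemma adjoin_line_subspace : is_subspace K (adjoin_line H x).
Proof.
case/is_subspaceP: (H_subspace) => H0 HD HZ; apply/is_subspaceP; split.
- by apply/imset2P; exists 0 0; rewrite ?subfield0 // mul0r addr0.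
- move=> _ _ /imset2P[h c Hh Kc ->] /imset2P[h' c' Hh' Kc' ->].
  by apply/imset2P; exists (h + h') (c + c'); rewrite ?HD ?subfieldD //; ring.
- move=> d _ Kd /imset2P[h c Hh Kc ->].
  by apply/imset2P; exists (d * h) (d * c); rewrite ?HZ ?subfieldM //; ring.
Qed.

Lemma adjoin_line_sub W : is_subspace K W ->
  (adjoin_line H x \subset W) = (H \subset W) && (x \in W).
Proof.
case/is_subspaceP: (H_subspace) => H0 _ _ /is_subspaceP[W0 WD WZ].
apply/subsetP/andP => [sW|[/subsetP sHW Wx] y]; last first.
  by case/imset2P => h c Hh Kc ->; apply: WD; [exact: sHW|exact: WZ].
split.
  apply/subsetP => h Hh; apply: sW; apply/imset2P; exists h 0 => //.
    exact: subfield0.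
  by rewrite mul0r addr0.
by apply: sW; apply/imset2P; exists 0 1; rewrite ?subfield1 // mul1r add0r.
Qed.

Lemma card_adjoin_line : x \notin H -> #|adjoin_line H x| = (#|K| * #|H|)%N.
Proof.
case/is_subspaceP: (H_subspace) => H0 HD HZ Hx; rewrite mulnC -cardsX.
rewrite /adjoin_line curry_imset2X card_in_imset // => -[h c] [h' c'].
rewrite !inE /= => /andP[Hh Kc] /andP[Hh' Kc'] E.
have E' : (c - c') * x = h' - h by rewrite -[h'](addrK (c' * x)) -E; ring.
have [/eqP|cc'] := eqVneq (c - c') 0.
  rewrite subr_eq0 => /eqP ecc; move: E; rewrite ecc => /addIr ->; by [].
case/negP: Hx; rewrite -[x](mulKf cc') E' HZ ?subspaceB //.
by rewrite subfieldV // subfieldB.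
Qed.

End AdjoinLine.

(** A subspace containing [H] is built from [H] by adjoining lines, each of
    which multiplies the cardinal by [#|K|]. *)
Lemma card_subspace_over H W : is_subspace K H -> is_subspace K W ->
  H \subset W -> exists n, #|W| = (#|K| ^ n * #|H|)%N.
Proof.
move=> + Wsp; have [m] := ubnP (#|W| - #|H|)%N.
elim: m H => // m IHm H ltm Hsp sHW.
have [sWH|] := boolP (W \subset H).
  have /eqP -> : W == H by rewrite eqEsubset sWH.
  by exists 0%N; rewrite mul1n.
case/subsetPn => x Wx Hx.
have cH : (0 < #|H|)%N := card_subspace_gt0 Hsp.
have sL : adjoin_line H x \subset W by rewrite adjoin_line_sub ?sHW.
have [||n ->] := IHm (adjoin_line H x) _ _ sL.
- have := subset_leq_card sL; rewrite card_adjoin_line //.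
  have : (#|H| < #|K| * #|H|)%N by rewrite ltn_Pmull // card_subfield_gt1.
  by move=> h1 h2; rewrite -ltnS (leq_trans _ ltm) // ltnS ltn_sub2l // (leq_trans h1).
- exact: adjoin_line_subspace.
by exists n.+1; rewrite card_adjoin_line // expnSr mulnA.
Qed.

Definition intermediate H W l : {set {set F}} :=
  [set L | [&& is_subspace K L, H \subset L, L \subset W
             & #|L| == (#|K| ^ l * #|H|)%N]].

(** Counting the pairs of a vector [x] of [W] outside [H] and an intermediate
    space [L] that contains [x] in two ways gives the recurrence of the
    Gaussian binomial coefficients: each [L] has [(#|K| ^ l - 1) * #|H|] such
    vectors, and the [L] above a given [x] are those that contain the space
    [H + K x], of codimension [n - 1] in [W]. *)
Lemma card_intermediate H W n l : is_subspace K H -> is_subspace K W ->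
  H \subset W -> #|W| = (#|K| ^ n * #|H|)%N ->
  #|intermediate H W l|%:R = gauss_binom n l #|K|%:R.
Proof.
have Q1 : (1 : rat) < #|K|%:R by rewrite ltr1n card_subfield_gt1.
elim: l H n => [|l IHl] H n Hsp Wsp sHW cW.
  rewrite gauss_binom0 (_ : intermediate H W 0 = [set H]) ?cards1 //.
  apply/setP => L; rewrite !inE mul1n; apply/and4P/eqP => [[_ sHL _ cL]|->].
    by apply/esym/eqP; rewrite eqEcard sHL (eqP cL) /=.
  by [].
have cH : (0 < #|H|)%N := card_subspace_gt0 Hsp.
case: n cW => [|n] cW.
  rewrite gauss_binom_small // (_ : intermediate H W _ = set0) ?cards0 //.
  apply/setP => L; rewrite !inE; apply/negP => /and4P[_ _ /subset_leq_card].
  rewrite cW => leL /eqP cL; move: leL.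
  by rewrite cL leq_mul2r eqn0Ngt cH /= leqNgt ltn_exp2l // card_subfield_gt1.
have cHq : (#|H|%:R : rat) != 0 by rewrite pnatr_eq0 -lt0n.
have eqpairs : (\sum_(L in intermediate H W l.+1) #|L :\: H| =
    \sum_(x in W :\: H) #|intermediate (adjoin_line H x) W l|)%N.
  under eq_bigr do rewrite -sum1_card.
  under [RHS]eq_bigr do rewrite -sum1_card.
  rewrite (exchange_big_dep (mem (W :\: H))) /=.
    apply: eq_bigr => x; rewrite inE => /andP[Hx Wx]; apply: eq_bigl => L.
    rewrite !inE Hx /= card_adjoin_line // mulnA -expnSr.
    case Lsp: (is_subspace K L); rewrite //= adjoin_line_sub //.
    by case: (H \subset L); rewrite ?andbF //= andbC.
  move=> L x; rewrite !inE => /and4P[_ _ /subsetP sLW _] /andP[-> /sLW ->] //.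
move/(congr1 (fun m => m%:R : rat)): eqpairs; rewrite !natr_sum.
rewrite (eq_bigr (fun=> (#|K|%:R ^+ l.+1 - 1) * #|H|%:R)); last first.
  move=> L; rewrite inE => /and4P[_ sHL _ /eqP cL].
  rewrite cardsD (setIidPr sHL) cL natrB ?leq_pmull ?expn_gt0 ?(ltnW card_subfield_gt1) //.
  by rewrite natrM natrX; ring.
rewrite [X in _ = X -> _](eq_bigr (fun=> gauss_binom n l #|K|%:R)) => [|x]; last first.
  rewrite inE => /andP[Hx Wx]; apply: IHl => //.
  - exact: adjoin_line_subspace.
  - by rewrite adjoin_line_sub ?sHW.
  - by rewrite card_adjoin_line // mulnA -expnSr.
rewrite !sumr_const cardsD (setIidPr sHW) cW -[_ *+ #|_|]mulr_natr.
rewrite -[gauss_binom _ _ _ *+ _]mulr_natr natrB ?leq_pmull ?expn_gt0 ?(ltnW card_subfield_gt1) //.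
rewrite natrM natrX gauss_binomSS // => E.
have := subr1X_neq0 Q1 l; have := subr1X_neq0 Q1 n.
move: E; set A := _ ^+ l.+1; set C := _ ^+ n.+1; set g := gauss_binom _ _ _.
set N := (#|_|%:R : rat) => E C1 A1.
apply: (mulIf cHq); apply: (mulIf A1); rewrite mulrAC.
transitivity (- ((A - 1) * #|H|%:R * N)); first by ring.
by rewrite E; field.
Qed.

(** Moebius inversion in the lattice of [K]-subspaces above [H]. *)
Lemma subspace_moebius H W m L : is_subspace K H -> is_subspace K W ->
  H \subset W -> #|W| = (#|K| ^ m * #|H|)%N -> (m <= L)%N ->
  \sum_(0 <= l < L.+1) (-1) ^+ l * #|K|%:R ^+ 'C(l, 2) *
    #|intermediate H W l|%:R = (W == H)%:R :> rat.
Proof.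
move=> Hsp Wsp sHW cW lemL.
have Q1 : (1 : rat) < #|K|%:R by rewrite ltr1n card_subfield_gt1.
under eq_bigr do rewrite (card_intermediate _ Hsp Wsp sHW cW).
rewrite sum_gauss_binom //.
have cH : (0 < #|H|)%N := card_subspace_gt0 Hsp.
suff -> : (W == H) = (m == 0%N) by [].
rewrite eq_sym eqEcard sHW cW /=; case: m {cW lemL} => [|m]; first by rewrite mul1n leqnn.
by rewrite leqNgt ltn_Pmull // -(expn0 #|K|) ltn_exp2l // card_subfield_gt1.
Qed.

End Subfield.

End Subspaces.

(** * Affine stability and the field generated by a root of unity *)

Section Stability.

Variable F : finFieldType.
Implicit Types (a b c d h x y : F) (H K W B : {set F}).

Definition stable B a b := [forall x in B, a * x + b \in B].

(** The stabilizer of [B] in the group of translations. *)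
Definition transl B : {set F} := [set h | stable B 1 h].

Lemma stableP B a b :
  reflect {in B, forall x, a * x + b \in B} (stable B a b).
Proof. exact: 'forall_implyP. Qed.

Lemma affine_inj a b : a != 0 -> injective (fun x => a * x + b).
Proof. by move=> a0 x y /addIr /(mulfI a0). Qed.

Lemma stable_imset B a b : a != 0 ->
  ([set a * x + b | x in B] == B) = stable B a b.
Proof.
move=> a0; rewrite eqEcard card_imset ?leqnn ?andbT; last exact: affine_inj.
apply/subsetP/stableP => [sB x Bx|sB _ /imsetP[x Bx ->]]; last exact: sB.
by apply: sB; apply: imset_f.
Qed.

Lemma stable_mem B a b x : a != 0 -> stable B a b ->
  (a * x + b \in B) = (x \in B).
Proof.
move=> a0; rewrite -(stable_imset B b a0) => /eqP E.
by rewrite -{1}E; apply: (mem_imset B x (@affine_inj a b a0)).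
Qed.

Lemma stable_id B : stable B 1 0.
Proof. by apply/stableP => x; rewrite mul1r addr0. Qed.

Lemma stable_comp B a b c d : stable B a b -> stable B c d ->
  stable B (a * c) (a * d + b).
Proof.
move=> /stableP sab /stableP scd; apply/stableP => x Bx.
by rewrite -mulrA addrA -mulrDr sab ?scd.
Qed.

Lemma stable_inv B a b : a != 0 -> stable B a b ->
  stable B a^-1 (- (a^-1 * b)).
Proof.
move=> a0 sB; apply/stableP => x Bx.
by rewrite -(stable_mem _ a0 sB) -mulrBr mulVKf // subrK.
Qed.

Lemma stableX B a n : stable B a 0 -> stable B (a ^+ n) 0.
Proof.
move=> sB; elim: n => [|n IHn]; first exact: stable_id.
by have := stable_comp sB IHn; rewrite mulr0 addr0 -exprS.
Qed.

Lemma transl_zmod B : zmod_closed (transl B).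
Proof.
split=> [|x y]; rewrite !inE; first exact: stable_id.
move=> sx sy; have := stable_comp (stable_inv (oner_neq0 _) sy) sx.
by rewrite invr1 !mul1r.
Qed.

Lemma HprimeP H a : reflect {in H, forall h, a * h \in H} (a \in Hprime H).
Proof. by rewrite inE; apply: 'forall_implyP. Qed.

(** Conjugation by [x |-> a * x + b] multiplies a translation vector by [a]. *)
Lemma stable_Hprime B a b : a != 0 -> stable B a b -> a \in Hprime (transl B).
Proof.
move=> a0 sB; apply/HprimeP => h; rewrite !inE => sh.
have := stable_comp (stable_comp sB sh) (stable_inv a0 sB).
rewrite mulr1 divff // => sah.
by rewrite (_ : a * h = a * - (a^-1 * b) + (a * h + b)) //; field.
Qed.

(** Closure under inverses uses that [H] is finite: multiplication by [y != 0]
    maps [H] into itself, hence onto itself. *)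
Lemma Hprime_subfield H : zmod_closed H -> is_subfield (Hprime H).
Proof.
case=> H0 HB; apply/is_subfieldP; split.
- by apply/HprimeP => h; rewrite mul1r.
- move=> x y /HprimeP Hx /HprimeP Hy; apply/HprimeP => h Hh.
  by rewrite mulrBl HB ?Hx ?Hy.
- move=> x y /HprimeP Hx /HprimeP Hy; apply/HprimeP => h Hh.
  have [->|y0] := eqVneq y 0; first by rewrite invr0 mulr0 mul0r.
  rewrite -mulrA Hx //.
  have sy : stable H y 0 by apply/stableP => z Hz; rewrite addr0 Hy.
  by rewrite -(stable_mem _ y0 sy) addr0 mulVKf.
Qed.

Lemma Fp_adjoin_min a K : is_subfield K -> a \in K -> Fp_adjoin a \subset K.
Proof. by move=> Ksf Ka; apply: bigcap_inf; rewrite Ksf. Qed.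

Lemma Fp_adjoin_id a : a \in Fp_adjoin a.
Proof. by apply/bigcapP => K /andP[]. Qed.

Lemma Fp_adjoin_subfield a : is_subfield (Fp_adjoin a).
Proof.
apply/is_subfieldP; split.
- by apply/bigcapP => K /andP[Ksf _]; apply: subfield1.
- move=> x y /bigcapP Kx /bigcapP Ky; apply/bigcapP => K Ka.
  by case/andP: (Ka) => Ksf _; apply: subfieldB; [|apply: Kx|apply: Ky].
- move=> x y /bigcapP Kx /bigcapP Ky; apply/bigcapP => K Ka.
  by case/andP: (Ka) => Ksf _; apply: subfield_div; [|apply: Kx|apply: Ky].
Qed.

(** To be an [F_p(a)]-subspace it is enough to be stable under [a], because
    [Hprime H] is one of the subfields that [Fp_adjoin a] intersects. *)
Lemma Fp_adjoin_subspace a H : zmod_closed H -> a \in Hprime H ->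
  is_subspace (Fp_adjoin a) H.
Proof.
move=> Hz aH; have H'sf := Hprime_subfield Hz; case: (Hz) => H0 HB.
apply/is_subspaceP; split=> // [x y Hx Hy|c x Kc Hx].
  by rewrite -[y]opprK HB // -sub0r HB.
by move/subsetP: (Fp_adjoin_min H'sf aH) => /(_ c Kc) /HprimeP; apply.
Qed.

Lemma subspace_zmod K H : is_subfield K -> is_subspace K H -> zmod_closed H.
Proof.
move=> Ksf Hsp; split; first by case/is_subspaceP: Hsp.
by move=> x y; apply: (subspaceB Ksf Hsp).
Qed.

Lemma primitive_root_neq0 u a : u.-primitive_root a -> a != 0.
Proof.
move=> a_prim; apply/eqP => a0; have /eqP := prim_expr_order a_prim.
by rewrite a0 expr0n gtn_eqF ?(prim_order_gt0 a_prim) // eq_sym oner_eq0.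
Qed.

Lemma card_Frobenius_fixed n : (1 < n)%N ->
  (#|[set x : F | x ^+ n == x]| <= n)%N.
Proof.
move=> n1; have szp : size ('X^n - 'X : {poly F}) = n.+1.
  by rewrite size_polyDl ?size_polyXn // size_polyN size_polyX.
rewrite -ltnS -szp cardE; apply: max_poly_roots; last exact: enum_uniq.
  by rewrite -size_poly_gt0 szp.
by apply/allP => x; rewrite mem_enum inE rootE !hornerE subr_eq0.
Qed.

Lemma card_subfield_pfactor p alpha K : prime p -> #|F| = (p ^ alpha)%N ->
  is_subfield K -> exists2 m, (0 < m)%N & #|K| = (p ^ m)%N.
Proof.
move=> p_pr cF Ksf.
have sp0 : is_subspace K [set 0].
  apply/is_subspaceP; split=> [|x y|c x _]; rewrite !inE //.
    by move=> /eqP-> /eqP->; rewrite addr0.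
  by move=> /eqP->; rewrite mulr0.
have [n] := card_subspace_over Ksf sp0 (full_subspace K) (subsetT _).
rewrite cards1 muln1 cardsT cF => E.
have K1 := card_subfield_gt1 Ksf.
have dK : (#|K| %| p ^ alpha)%N.
  case: n E => [|n] E; last by rewrite E expnS dvdn_mulr.
  by have := leq_trans K1 (max_card (mem K)); rewrite cF E.
case/(dvdn_pfactor _ _ p_pr): dK => m _ cK; exists m => //.
by case: m cK K1 => // ->.
Qed.

(** Let [K] be the field [Fp_adjoin a] and [o] the order of [p] modulo [u]. On
    one side [u], the order of [a],
    divides [#|K| - 1], which makes [#|K|] at least [p ^ o]; on the other side
    every element of [K] is fixed by [x |-> x ^+ (p ^ o)], because [a] is, and
    there are at most [p ^ o] such elements. *)
Lemma card_Fp_adjoin p alpha u a : prime p -> #|F| = (p ^ alpha)%N ->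
  u.-primitive_root a -> #|Fp_adjoin a| = (p ^ mulord u p)%N.
Proof.
move=> p_pr cF a_prim; set K := Fp_adjoin a.
have Ksf : is_subfield K := Fp_adjoin_subfield a.
have p1 := prime_gt1 p_pr; have p0 := prime_gt0 p_pr.
have [m m0 cK] := card_subfield_pfactor p_pr cF Ksf.
have a0 : a != 0 := primitive_root_neq0 a_prim.
have ud : (u %| p ^ m - 1)%N.
  by rewrite (prim_order_dvd a_prim) -cK subfield_expr_card // Fp_adjoin_id.
have upm : p ^ m == 1 %[mod u] by rewrite eqn_mod_dvd // expn_gt0 p0.
have cup : coprime u p.
  rewrite coprime_sym -(coprime_pexpl _ _ m0); apply: (coprime_dvdr ud).
  by rewrite subn1 coprimenP // expn_gt0 p0.
rewrite /mulord; case: ex_minnP => o /andP[o0]; rewrite cup /= => upo o_min.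
have leom : (o <= m)%N by apply: o_min; rewrite m0 upm.
have po1 : (1 < p ^ o)%N by rewrite -(expn0 p) ltn_exp2l.
have pchF := card_finPcharP cF p_pr.
have po : [pchar F].-nat (p ^ o)%N.
  by rewrite pnatX pnatE // pchF.
(* [K] maps the fixed points of the Frobenius power to themselves, hence, since
   1 is one of them, [K] consists of fixed points. *)
pose W := [set x : F | x ^+ (p ^ o) == x].
have Wz : zmod_closed W.
  split=> [|x y]; rewrite !inE; first by rewrite expr0n expn_eq0 gtn_eqF.
  move=> /eqP ex /eqP ey; apply/eqP.
  by rewrite exprDn_pchar // exprNn_pchar // ex ey.
have aW : a \in Hprime W.
  apply/HprimeP => x; rewrite !inE exprMn => /eqP ->.
  by have /eqP -> : a ^+ (p ^ o) == a ^+ 1 by rewrite (eq_prim_root_expr a_prim).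
have sKW : K \subset W.
  apply/subsetP => x Kx.
  have /HprimeP/(_ 1) := subsetP (Fp_adjoin_min (Hprime_subfield Wz) aW) x Kx.
  by rewrite mulr1; apply; rewrite inE expr1n.
have := leq_trans (subset_leq_card sKW) (card_Frobenius_fixed po1).
rewrite cK leq_exp2l // => lemo.
by congr (_ ^ _)%N; apply/eqP; rewrite eqn_leq leom lemo.
Qed.

End Stability.

(** * Counting invariant sets *)

Lemma binom_rat_nat N j : binom_rat N%:R j%:R = 'C(N, j)%:R.
Proof.
rewrite /binom_rat natr_nat natrK.
elim: j => [|j IHj]; first by rewrite big_ord0 bin0.
rewrite big_ord_recr /= IHj.
have j1 : (j.+1%:R : rat) != 0 by rewrite pnatr_eq0.
apply: (mulfI j1); rewrite -natrM mul_bin_left mulrCA [X in _ * X]mulrC divfK //.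
have [leNj|ltjN] := leqP j N; first by rewrite natrM natrB // mulrC.
by rewrite bin_small // mul0r muln0.
Qed.

Lemma binom_rat_div N j m : (0 < m)%N ->
  binom_rat N%:R (j%:R / m%:R) = (if m %| j then 'C(N, j %/ m) else 0)%N%:R.
Proof.
move=> m0; have m0' : (m%:R : rat) != 0 by rewrite pnatr_eq0 -lt0n.
case: ifPn => [mj|]; first by rewrite -{1}(divnK mj) natrM mulfK // binom_rat_nat.
apply: contraNeq; rewrite /binom_rat; case: natrP => [[i Ei] _|_ /eqP //].
by move/(canRL (divfK m0')): Ei => /eqP; rewrite -natrM eqr_nat => /eqP->; rewrite dvdn_mull.
Qed.

Lemma binom_rat_neg x y : y < 0 -> binom_rat x y = 0.
Proof.
by move=> y0; rewrite /binom_rat; case: natrP => // -[n En]; rewrite En ltrn0 in y0.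
Qed.

Section BlockUnions.

Variables (T : finType) (P : {set {set T}}) (D : {set T}) (m : nat).
Hypotheses (partPD : partition P D) (m_gt0 : (0 < m)%N).
Hypothesis cardP : {in P, forall A : {set T}, #|A| = m}.

Lemma blocks_cover (Y : {set {set T}}) : Y \subset P -> P ::&: cover Y = Y.
Proof.
case/and3P: partPD => _ tP P0 /subsetP sYP; apply/setP => A; rewrite inE.
apply/andP/idP => [[PA sA]|YA]; last by split; rewrite ?sYP //; apply: bigcup_sup.
have [x Ax] : exists x, x \in A by apply/set0Pn; apply: contraNneq P0 => <-.
have /bigcupP[C YC Cx] := subsetP sA x Ax.
by rewrite -(def_pblock tP PA Ax) (def_pblock tP (sYP _ YC) Cx).
Qed.

(** A set [B] is a union of blocks exactly when it is the union of the blocks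
    that it contains, and it is determined by these blocks. *)
Lemma card_block_unions k :
  #|[set B : {set T} | (B == cover (P ::&: B)) && (#|B| == k)]| =
    (if m %| k then 'C(#|P|, k %/ m) else 0)%N.
Proof.
have cY (Y : {set {set T}}) : Y \subset P -> #|cover Y| = (#|Y| * m)%N.
  case/and3P: partPD => _ tP P0 sYP; apply: card_uniform_partition.
    by move=> A /(subsetP sYP); apply: cardP.
  by rewrite /partition eqxx (trivIsetS sYP) //; apply: contra P0; apply: (subsetP sYP).
have -> : [set B : {set T} | (B == cover (P ::&: B)) && (#|B| == k)] =
    cover @: [set Y : {set {set T}} | Y \subset P & #|Y| * m == k]%N.
  apply/setP => B; rewrite inE; apply/andP/imsetP => [[/eqP EB cB]|[Y]].
    have sP : P ::&: B \subset P by apply/subsetP => A; rewrite inE => /andP[].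
    by exists (P ::&: B); rewrite // inE sP -cY // -EB.
  by rewrite inE => /andP[sYP cB] ->; rewrite blocks_cover // cY.
rewrite card_in_imset; last first.
  move=> Y Z; rewrite !inE => /andP[sY _] /andP[sZ _] E.
  by rewrite -(blocks_cover sY) E blocks_cover.
case: ifPn => [mk|nmk].
  rewrite -cards_draws; apply: eq_card => Y; rewrite !inE.
  by rewrite -{1}(divnK mk) eqn_pmul2r.
apply: eq_card0 => Y; rewrite !inE; apply/negP => /andP[_ /eqP E].
by case/negP: nmk; rewrite -E dvdn_mull.
Qed.

End BlockUnions.

Section StableSets.

Variables (F : finFieldType) (u : nat) (a : F) (W : {set F}).
Implicit Types (B C : {set F}) (x y w : F).
Hypothesis a_prim : u.-primitive_root a.
Hypothesis W_subspace : is_subspace (Fp_adjoin a) W.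

Let u_gt0 : (0 < u)%N. Proof. exact: prim_order_gt0 a_prim. Qed.

Let Ksf := Fp_adjoin_subfield a.

Let a0 : a != 0. Proof. exact: primitive_root_neq0 a_prim. Qed.

Let W0 : 0 \in W. Proof. by case/is_subspaceP: W_subspace. Qed.
Let WD : {in W &, forall x y, x + y \in W}.
Proof. by case/is_subspaceP: W_subspace. Qed.
Let WB : {in W &, forall x y, x - y \in W}.
Proof. exact: (subspaceB Ksf W_subspace). Qed.
Let WX i : {in W, forall x, a ^+ i * x \in W}.
Proof.
case/is_subspaceP: W_subspace => _ _ WZ x Wx.
by rewrite WZ // subfieldX // Fp_adjoin_id.
Qed.

(** Invariance under the group generated by [x |-> a * x] and the translations
    by [W]. *)
Definition affine_invariant (B : {set F}) := stable B a 0 && (W \subset transl B).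

Lemma invariantP B : reflect
  ((forall i x, x \in B -> a ^+ i * x \in B) /\ {in B & W, forall x w, x + w \in B})
  (affine_invariant B).
Proof.
apply: (iffP andP) => -[sa sW]; split.
- by move=> i x Bx; have /stableP/(_ x Bx) := stableX i sa; rewrite addr0.
- move=> x w Bx Ww; have := subsetP sW w Ww; rewrite inE => /stableP/(_ x Bx).
  by rewrite mul1r.
- by apply/stableP => x Bx; rewrite addr0 (sa 1%N).
- apply/subsetP => w Ww; rewrite inE; apply/stableP => x Bx.
  by rewrite mul1r sW.
Qed.

Lemma invariant_memW B x w : affine_invariant B -> w \in W ->
  (x + w \in B) = (x \in B).
Proof.
case/invariantP=> _ sW Ww; apply/idP/idP => Bx; last exact: sW.
by rewrite -(addrK w x) sW // -sub0r WB.
Qed.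

Lemma invariant_memX B x : affine_invariant B -> (a * x \in B) = (x \in B).
Proof. by case/andP=> sa _; rewrite -(stable_mem x a0 sa) addr0. Qed.

Lemma invariantI B : (forall y, (a * y \in B) = (y \in B)) ->
   (forall y w, w \in W -> (y + w \in B) = (y \in B)) -> affine_invariant B.
Proof.
move=> ha hw; apply/andP; split; first by apply/stableP => y; rewrite addr0 ha.
by apply/subsetP => w Ww; rewrite inE; apply/stableP => y; rewrite mul1r hw.
Qed.

Lemma invariant_W : affine_invariant W.
Proof. by apply/invariantP; split=> [i x|x w]; [apply: WX|apply: WD]. Qed.

Lemma invariantU B : affine_invariant B -> affine_invariant (B :|: W).
Proof.
move=> iB; apply: invariantI => [y|y w Ww].
  by rewrite !inE !(invariant_memX _ invariant_W) (invariant_memX _ iB).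
by rewrite !inE !(invariant_memW _ invariant_W) ?(invariant_memW _ iB).
Qed.

Lemma invariantDW B : affine_invariant B -> affine_invariant (B :\: W).
Proof.
move=> iB; apply: invariantI => [y|y w Ww].
  by rewrite !inE !(invariant_memX _ invariant_W) (invariant_memX _ iB).
by rewrite !inE !(invariant_memW _ invariant_W) ?(invariant_memW _ iB).
Qed.

Definition affine_orbit x : {set F} :=
  [set a ^+ nat_of_ord i * x + w | i in [set: 'I_u], w in W].

Lemma affine_orbit_mem i w x : w \in W -> a ^+ i * x + w \in affine_orbit x.
Proof.
move=> Ww; rewrite -(prim_expr_mod a_prim).
have lti : (i %% u < u)%N by rewrite ltn_mod.
by apply/imset2P; exists (Ordinal lti) w; rewrite ?inE.
Qed.

Lemma affine_orbit_id x : x \in affine_orbit x.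
Proof. by have := affine_orbit_mem 0 x W0; rewrite mul1r addr0. Qed.

Lemma affine_orbit_sub x y : y \in affine_orbit x ->
  affine_orbit y \subset affine_orbit x.
Proof.
case/imset2P => i w _ Ww ->; apply/subsetP => _ /imset2P[j w' _ Ww' ->].
by rewrite mulrDr mulrA -exprD -addrA affine_orbit_mem // WD // WX.
Qed.

Lemma affine_orbit_invariant x : affine_invariant (affine_orbit x).
Proof.
apply/invariantP; split=> [i y yx|y w yx Ww]; apply: (subsetP (affine_orbit_sub yx)).
  by rewrite -[a ^+ i * y]addr0 affine_orbit_mem.
by have := affine_orbit_mem 0 y Ww; rewrite mul1r.
Qed.

Lemma affine_orbit_subset_invariant B x : affine_invariant B -> x \in B ->
  affine_orbit x \subset B.
Proof.
case/invariantP=> sa sW Bx; apply/subsetP => _ /imset2P[i w _ Ww ->].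
by rewrite sW // sa.
Qed.

(** Outside [W] the group generated by [a] and the translations by [W] acts
    freely: [a ^+ i - a ^+ j] is invertible in the field over which [W] is a
    vector space. *)
Lemma card_affine_orbit x : x \notin W -> #|affine_orbit x| = (u * #|W|)%N.
Proof.
move=> Wx; rewrite /affine_orbit curry_imset2X card_in_imset; last first.
  move=> [i w] [j w']; rewrite !inE /= => Ww Ww' E.
  have E' : (a ^+ i - a ^+ j) * x = w' - w.
    by rewrite mulrBl; apply/eqP; rewrite subr_eq addrAC eq_sym subr_eq addrC E addrC.
  have [/eqP|aij] := eqVneq (a ^+ i - a ^+ j) 0.
    rewrite subr_eq0 (eq_prim_root_expr a_prim) !modn_small // => /eqP/val_inj eij.
    by move: E; rewrite eij => /addrI ->.
  case/negP: Wx; rewrite -[x](mulKf aij) E'; case/is_subspaceP: W_subspace => _ _.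
  by apply; rewrite ?WB // subfieldV // subfieldB // subfieldX // Fp_adjoin_id.
by rewrite cardsX cardsT card_ord.
Qed.

Definition affine_orbits := affine_orbit @: ~: W.

Lemma affine_orbit_notinW x y : x \notin W -> y \in affine_orbit x -> y \notin W.
Proof.
move=> Wx /imset2P[i w _ Ww ->]; apply: contra Wx.
rewrite (invariant_memW _ invariant_W) //; elim: (i : nat) => [|n IHn].
  by rewrite mul1r.
by rewrite exprS -mulrA (invariant_memX _ invariant_W).
Qed.

Lemma affine_orbit_eq x y : x \notin W -> y \in affine_orbit x ->
  affine_orbit y = affine_orbit x.
Proof.
move=> Wx yx; apply/eqP; rewrite eqEcard affine_orbit_sub // !card_affine_orbit //.
  by rewrite leqnn.
exact: (affine_orbit_notinW Wx yx).
Qed.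

Lemma affine_orbits_partition : partition affine_orbits (~: W).
Proof.
apply/and3P; split.
- apply/eqP/setP => x; rewrite inE; apply/bigcupP/idP => [[_ /imsetP[y + ->]]|Wx].
    by rewrite inE => Wy /(affine_orbit_notinW Wy).
  by exists (affine_orbit x); rewrite ?affine_orbit_id // imset_f // inE.
- apply/trivIsetP => _ _ /imsetP[x + ->] /imsetP[y + ->]; rewrite !inE => Wx Wy.
  apply: contraNT => /pred0Pn[z /andP[zx zy]].
  by rewrite -(affine_orbit_eq Wx zx) (affine_orbit_eq Wy zy).
- apply/imsetP => -[x _ E]; have := affine_orbit_id x; by rewrite -E inE.
Qed.

Lemma invariant_blocks B :
  (B == cover (affine_orbits ::&: B)) = affine_invariant B && (B \subset ~: W).
Proof.
apply/eqP/andP => [->|[iB sB]]; last first.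
  apply/setP => x; apply/idP/bigcupP => [Bx|[A]]; last first.
    by rewrite inE => /andP[_ /subsetP sA] /sA.
  exists (affine_orbit x); rewrite ?affine_orbit_id // inE (affine_orbit_subset_invariant iB) //.
  by rewrite imset_f // (subsetP sB).
have inO x : x \in cover (affine_orbits ::&: B) ->
    exists y, [/\ y \notin W, affine_orbit y \subset B & x \in affine_orbit y].
  case/bigcupP => A; rewrite inE => /andP[/imsetP[y + ->] sy] xy.
  by rewrite inE => Wy; exists y.
have memO x y : y \notin W -> affine_orbit y \subset B -> x \in affine_orbit y ->
    x \in cover (affine_orbits ::&: B).
  move=> Wy sy xy; apply/bigcupP; exists (affine_orbit y) => //.
  by rewrite inE sy andbT imset_f // inE.
split.
  apply/invariantP; split=> [i x|x w] /inO[y [Wy sy xy]] => [|Ww];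
    apply: (memO _ y) => //; case/invariantP: (affine_orbit_invariant y) => h1 h2.
    exact: h1.
  exact: h2.
by apply/subsetP => x /inO[y [Wy _ /(affine_orbit_notinW Wy)]]; rewrite inE.
Qed.

Lemma invariant_disjointVsub B : affine_invariant B ->
  (B \subset ~: W) = ~~ (W \subset B).
Proof.
move=> iB; apply/idP/idP => [sB|]; last first.
  apply: contraNT => /subsetPn[x Bx]; rewrite inE negbK => Wx.
  by apply/subsetP => w Ww; rewrite -(subrK x w) addrC (invariant_memW _ iB) ?WB.
by apply/subsetPn; exists 0; rewrite ?W0 //; apply/negP => /(subsetP sB); rewrite inE W0.
Qed.

(** An invariant set either avoids [W] or contains it, since [W] is itself an
    orbit; the two terms of [s_qk] count these two kinds of sets. Outside [W]
    such a set is an arbitrary union of orbits, all of cardinal [u * #|W|]. *)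
Lemma card_invariant k :
  #|[set B | affine_invariant B & #|B| == k]|%:R = s_qk #|F| k u #|W|.
Proof.
set v := #|W|; pose m := (u * v)%N.
have v0 : (0 < v)%N by apply/card_gt0P; exists 0.
have m0 : (0 < m)%N by rewrite muln_gt0 u_gt0.
pose U j := [set B : {set F} | (B == cover (affine_orbits ::&: B)) && (#|B| == j)].
have cO A : A \in affine_orbits -> #|A| = m.
  by case/imsetP => x; rewrite inE => Wx ->; rewrite card_affine_orbit.
have cU j : #|U j|%:R = binom_rat ((#|F|%:R - v%:R) / m%:R) (j%:R / m%:R).
  rewrite -natrB ?max_card // -(cardsC W) addKn.
  rewrite (card_uniform_partition cO affine_orbits_partition) natrM mulfK; last first.
    by rewrite pnatr_eq0 -lt0n.
  by rewrite binom_rat_div // (card_block_unions affine_orbits_partition m0 cO).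
rewrite /s_qk -/m -cU.
rewrite -(cardsID [set B : {set F} | ~~ (W \subset B)]) natrD; congr (_ + _).
  congr (_ %:R); apply: eq_card => B; rewrite !inE invariant_blocks.
  case iB: (affine_invariant B); rewrite //= invariant_disjointVsub // andbC //.
have [levk|ltkv] := leqP v k; last first.
  rewrite binom_rat_neg; last first.
    by rewrite pmulr_llt0 ?invr_gt0 ?ltr0n // subr_lt0 ltr_nat.
  apply/eqP; rewrite pnatr_eq0 cards_eq0; apply/eqP/setP => B; rewrite !inE negbK.
  apply/negP => /andP[/subset_leq_card sWB /andP[_ /eqP cB]].
  by move: ltkv; rewrite -cB ltnNge sWB.
rewrite -(natrB _ levk) -cU; congr (_ %:R).
rewrite -(card_in_imset (f := fun B => B :|: W) (D := mem (U (k - v)%N))); last first.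
  move=> B C; rewrite !inE !invariant_blocks.
  move=> /andP[/andP[_ sB] _] /andP[/andP[_ sC] _] E.
  have h (D : {set F}) : D \subset ~: W -> D = (D :|: W) :\: W.
    move=> sD; apply/setP => x; rewrite !inE; case Dx: (x \in D) => /=; last first.
      by case: (x \in W).
    by have := subsetP sD x Dx; rewrite inE andbT => ->.
  by rewrite (h _ sB) E -h.
apply: eq_card => B; rewrite !inE negbK; apply/idP/imsetP.
  move=> /andP[sWB /andP[iB /eqP cB]]; exists (B :\: W).
    rewrite inE invariant_blocks invariantDW //= subDset setUCr subsetT /=.
    by rewrite cardsD (setIidPr sWB) cB.
  by apply/setP => x; rewrite !inE; case Wx: (x \in W); rewrite ?orbF ?orbT //= (subsetP sWB).
move=> [C]; rewrite inE invariant_blocks => /andP[/andP[iC sC] /eqP cC] ->.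
rewrite subsetUr invariantU //= cardsU cC.
have /eqP -> : C :&: W == set0 by rewrite setI_eq0 disjoints_subset.
by rewrite cards0 subn0 subnK.
Qed.

End StableSets.

(** * Sets with a prescribed translation group *)

Section ExactTranslations.

Variable F : finFieldType.
Implicit Types (a b c h x y : F) (H K W B : {set F}).

(** Let [K] be the field generated by [a], with [p ^ o] elements. The
    translation vectors of a set stable under [a] form a [K]-space, so Moebius
    inversion over the [K]-spaces [W] that contain [H] expresses the number of
    sets with translation group exactly [H] by the numbers of sets invariant
    under [a] and [W]; these depend only on [#|W|], so the spaces of each
    dimension contribute a Gaussian binomial coefficient. *)
Lemma card_exact_transl p alpha beta k u a H :
    prime p -> #|F| = (p ^ alpha)%N -> u.-primitive_root a ->
    zmod_closed H -> a \in Hprime H -> #|H| = (p ^ beta)%N ->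
  let o := mulord u p in
  #|[set B | [&& transl B == H, #|B| == k & stable B a 0]]|%:R =
    \sum_(0 <= l < ((alpha - beta) %/ o).+1)
      (-1) ^+ l * p%:R ^+ (o * 'C(l, 2)) *
      gauss_binom ((alpha - beta) %/ o) l (p%:R ^+ o) *
      s_qk #|F| k u (p ^ (beta + l * o)).
Proof.
move=> p_pr cF a_prim Hz aH cH o; set K := Fp_adjoin a.
have p1 := prime_gt1 p_pr.
have a0 := primitive_root_neq0 a_prim.
have Ksf : is_subfield K := Fp_adjoin_subfield a.
have cK : #|K| = (p ^ o)%N := card_Fp_adjoin p_pr cF a_prim.
have o0 : (0 < o)%N by rewrite /o /mulord; case: ex_minnP => ? /andP[].
have Hsp : is_subspace K H := Fp_adjoin_subspace Hz aH.
have Tsp := full_subspace K.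
have [n cT] := card_subspace_over Ksf Hsp Tsp (subsetT _).
have -> : ((alpha - beta) %/ o)%N = n.
  move/eqP: (cT); rewrite cardsT cF cK cH -expnM -expnD eqn_exp2l // => /eqP->.
  by rewrite addnK mulKn.
have cKQ : (p%:R ^+ o : rat) = #|K|%:R by rewrite cK natrX.
pose mu l : rat := (-1) ^+ l * #|K|%:R ^+ 'C(l, 2).
pose X := [set B : {set F} | (#|B| == k) && stable B a 0].
pose above B l := [set W in intermediate K H setT l | W \subset transl B].
(* Exchanging the sums, each [B] contributes the Moebius sum over the spaces
   between [H] and its own translation group, which vanishes unless they are
   equal. *)
transitivity (\sum_(0 <= l < n.+1) mu l * (\sum_(B in X) #|above B l|%:R)).
  under eq_bigr do rewrite mulr_sumr.
  rewrite exchange_big /= -sum1_card natr_sum big_mkcond [RHS]big_mkcond /=.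
  apply: eq_bigr => B _; rewrite !inE.
  case: (boolP (#|B| == k)) => _; rewrite ?andbF //=.
  case: (boolP (stable B a 0)) => sB; rewrite ?andbF ?andbT //=.
  have [sHB|nsHB] := boolP (H \subset transl B); last first.
    rewrite big1 => [|l _].
      by case: eqP => // E; case/negP: nsHB; rewrite E.
    rewrite [above B l](_ : _ = set0) ?cards0 ?mulr0 //.
    apply/setP => W; rewrite !inE; apply: contraNF nsHB => /andP[/and4P[_ sHW _ _]].
    exact: subset_trans.
  have Bsp : is_subspace K (transl B).
    by apply: Fp_adjoin_subspace (transl_zmod B) _; apply: stable_Hprime sB.
  have [m cB] := card_subspace_over Ksf Hsp Bsp sHB.
  have lemn : (m <= n)%N.
    have := subset_leq_card (subsetT (transl B)); rewrite cB cT leq_pmul2r.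
      by rewrite leq_exp2l // card_subfield_gt1.
    by rewrite cH expn_gt0 prime_gt0.
  transitivity ((transl B == H)%:R : rat); first by case: eqP.
  rewrite -(subspace_moebius Ksf Hsp Bsp sHB cB lemn).
  apply: eq_bigr => l _; congr (_ * _%:R); apply: eq_card => W; rewrite !inE.
  rewrite subsetT; case: (is_subspace K W); case: (H \subset W) => //=.
  by rewrite andbC.
(* Exchanging them the other way, each [W] contributes the number of sets
   invariant under [a] and [W]. *)
have cardW W l : W \in intermediate K H setT l -> #|W| = (p ^ (beta + l * o))%N.
  by rewrite inE => /and4P[_ _ _ /eqP->]; rewrite cK cH -expnM -expnD addnC mulnC.
apply: eq_big_nat => l _; rewrite exprM cKQ -/(mu l) -mulrA; congr (_ * _).
rewrite -(card_intermediate Ksf l Hsp Tsp (subsetT _) cT) mulr_natl -sumr_const.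
rewrite -natr_sum.
transitivity ((\sum_(W in intermediate K H setT l)
    #|[set B | affine_invariant a W B & #|B| == k]|)%N%:R : rat); last first.
  rewrite natr_sum; apply: eq_bigr => W WI; rewrite -(cardW W l WI).
  by apply: card_invariant => //; move: WI; rewrite inE => /and4P[].
congr (_ %:R); under eq_bigr do rewrite -sum1_card.
under [RHS]eq_bigr do rewrite -sum1_card.
rewrite (exchange_big_dep (mem (intermediate K H setT l))) /=; last first.
  by move=> B W _; rewrite inE => /andP[].
apply: eq_bigr => W WI; apply: eq_bigl => B.
move: WI; rewrite !inE => -> /=.
by rewrite -andbA andbC.
Qed.

End ExactTranslations.

(** * Dilations and their centres *)

Section FixedPoints.

Variable F : finFieldType.
Implicit Types (a b c h t x y : F) (H K W B : {set F}).

(** [x |-> a * x + (c - a * c)] is the dilation of ratio [a] and centre [c]. *)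
Definition dilation_stable B c :=
  [exists a, [&& a != 0, a != 1 & stable B a (c - a * c)]].

(** An affine map that is not a translation fixes a point. *)
Lemma stable_dilation B a b : a != 0 -> a != 1 -> stable B a b ->
  dilation_stable B (b / (1 - a)).
Proof.
move=> a0 a1 sB; apply/existsP; exists a; rewrite a0 a1 /=.
rewrite (_ : _ - _ = b) //; field.
by rewrite subr_eq0 eq_sym.
Qed.

Definition translate t B : {set F} := [set x + t | x in B].

Lemma mem_translate t B x : (x \in translate t B) = (x - t \in B).
Proof.
apply/imsetP/idP => [[y By ->]|Bx]; first by rewrite addrK.
by exists (x - t); rewrite ?subrK.
Qed.

Lemma translate_inj t : injective (translate t).
Proof.
move=> B C E; apply/setP => x.
by rewrite -[x](addrK t) -!mem_translate E.
Qed.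

Lemma card_translate t B : #|translate t B| = #|B|.
Proof. by rewrite card_imset //; apply: addIr. Qed.

Lemma stable_translate t B a b :
  stable (translate t B) a b = stable B a (b + a * t - t).
Proof.
apply/stableP/stableP => sB x.
  move=> Bx; have := sB (x + t); rewrite !mem_translate addrK => /(_ Bx).
  by rewrite (_ : _ - t = a * x + (b + a * t - t)) //; ring.
rewrite !mem_translate => /sB.
by rewrite (_ : _ + _ = a * x + b - t) //; ring.
Qed.

Lemma transl_translate t B : transl (translate t B) = transl B.
Proof. by apply/setP => h; rewrite !inE stable_translate mul1r addrK. Qed.

Lemma dilation_stable_translate t B :
  dilation_stable (translate t B) t = dilation_stable B 0.
Proof.
apply: eq_existsb => a; rewrite stable_translate.
by rewrite subrK subrr mulr0 subrr.
Qed.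

(** The commutator of two dilations with centres [c] and [d] is a translation
    by a multiple of [c - d], so the centres of the dilations that preserve [B]
    differ by translation vectors of [B]. *)
Lemma dilation_stable_transl B c d : dilation_stable B c ->
  dilation_stable B d = (d - c \in transl B).
Proof.
case/existsP=> a /and3P[a0 a1 sa].
have Hsf := Hprime_subfield (transl_zmod B).
have aH := stable_Hprime a0 sa.
have Ha1 : 1 - a \in Hprime (transl B) by rewrite subfieldB // subfield1.
apply/idP/idP => [/existsP[e /and3P[e0 e1 se]]|dc].
  have eH := stable_Hprime e0 se.
  have He1 : 1 - e \in Hprime (transl B) by rewrite subfieldB // subfield1.
  have ae0 : a * e != 0 by rewrite mulf_neq0.
  have := stable_comp (stable_comp sa se)
            (stable_inv (mulf_neq0 e0 a0) (stable_comp se sa)).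
  set b := (_ + _); rewrite (_ : a * e * (e * a)^-1 = 1); last first.
    by rewrite [e * a]mulrC divff.
  have -> : b = (1 - a) * (1 - e) * (c - d) by rewrite /b; field; rewrite a0.
  move=> st; have n0 : (1 - a) * (1 - e) != 0.
    by rewrite mulf_neq0 // subr_eq0 eq_sym.
  have /HprimeP : ((1 - a) * (1 - e))^-1 \in Hprime (transl B).
    by rewrite subfieldV // subfieldM.
  move=> /(_ ((1 - a) * (1 - e) * (c - d))); rewrite inE st mulKf // => /(_ isT).
  by move=> h; rewrite -opprB -sub0r; have [z0 zB] := transl_zmod B; apply: zB.
apply/existsP; exists a; rewrite a0 a1 /=.
have /HprimeP/(_ _ dc) := Ha1; rewrite inE => st.
have := stable_comp st sa; rewrite !mul1r.
by rewrite [X in stable _ _ X -> _](_ : _ = d - a * d) //; ring.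
Qed.

(** A double count of the pairs of a set [B] and a centre [c] of a nontrivial
    dilation preserving [B]. *)
Lemma card_dilation_stable H k :
  (#|[set B | [&& transl B == H, #|B| == k & [exists c, dilation_stable B c]]]|
     * #|H| =
   #|F| * #|[set B | [&& transl B == H, #|B| == k & dilation_stable B 0%R]]|)%N.
Proof.
pose X := [set B : {set F} | (transl B == H) && (#|B| == k)].
have E : (\sum_(B in X) \sum_(c | dilation_stable B c) 1 =
    \sum_c \sum_(B in X | dilation_stable B c) 1)%N.
  by rewrite (exchange_big_dep predT).
transitivity (\sum_(B in X) \sum_(c | dilation_stable B c) 1)%N.
  rewrite -sum_nat_const big_mkcond [RHS]big_mkcond /=.
  apply: eq_bigr => B _; rewrite !inE.
  case: (transl B =P H) => // tB; case: (#|B| =P k) => // _.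
  case: existsP => [[c sc]|nc]; last first.
    by rewrite big_pred0 // => c; apply: contra_notF nc => sc; exists c.
  rewrite sum1dep_card.
  rewrite -tB -[LHS](card_translate c); apply: eq_card => d.
  by rewrite [RHS]inE mem_translate (dilation_stable_transl d sc).
rewrite E -sum_nat_const; apply: eq_bigr => c _; rewrite sum1_card.
rewrite -[RHS](card_imset _ (@translate_inj c)); apply: eq_card => B.
rewrite [LHS]inE !inE; apply/idP/imsetP => [|[C]].
  move=> /andP[/andP[/eqP tB cB] sB]; exists (translate (- c) B); last first.
    by apply/setP => x; rewrite !mem_translate opprK subrK.
  rewrite inE transl_translate card_translate tB eqxx cB /=.
  rewrite -(dilation_stable_translate c) (_ : translate c _ = B) //.
  by apply/setP => x; rewrite !mem_translate opprK subrK.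
rewrite inE => /and3P[/eqP tC cC sC] ->.
by rewrite transl_translate card_translate dilation_stable_translate tC eqxx cC sC.
Qed.
End FixedPoints.

(** * Inclusion-exclusion over prime orders *)

Lemma prod_primes_dvd m (s : seq nat) : uniq s -> all prime s ->
  (\prod_(e <- s) e %| m)%N = all (fun e => e %| m)%N s.
Proof.
elim: s => [|e s IHs] /=; first by rewrite big_nil dvd1n.
case/andP=> es us /andP[pe ps]; rewrite big_cons Gauss_dvd ?IHs //.
rewrite big_seq; apply: (big_ind (coprime e)) => [|x y ex ey|f sf].
- exact: coprimen1.
- by rewrite coprimeMr ex.
rewrite prime_coprime // dvdn_prime2 ?(allP ps f) //.
by apply: contraNneq es => ->.
Qed.

Lemma PiP_dvd n m (P : {set 'I_n}) : {in P, forall e : 'I_n, prime e} ->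
  reflect {in P, forall e : 'I_n, e %| m}%N (PiP P %| m)%N.
Proof.
move=> prP; have -> : PiP P = (\prod_(e <- map val (enum P)) e)%N.
  by rewrite big_map /PiP -big_enum.
rewrite prod_primes_dvd; last 2 first.
- by rewrite map_inj_uniq ?enum_uniq //; apply: val_inj.
- by apply/allP => _ /mapP[e + ->]; rewrite mem_enum => /prP.
apply: (iffP allP) => [h e Pe|h _ /mapP[e + ->]]; last by rewrite mem_enum => /h.
by apply: h; rewrite map_f // mem_enum.
Qed.

(** Expansion of the product of [-1 + 1] over [X]. *)
Lemma sum_sign_subsets (T : finType) (X : {set T}) :
  \sum_(P : {set T} | P \subset X) (-1) ^+ #|P| = (X == set0)%:R :> rat.
Proof.
pose f (i : T) : rat := if i \in X then -1 else 0.
transitivity (\prod_i (f i + 1)); last first.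
  have [X0|/set0Pn[x Xx]] := eqVneq X set0; last first.
    by rewrite (bigD1 x) //= /f Xx addNr mul0r.
  by rewrite big1 // => i _; rewrite /f X0 inE add0r.
rewrite bigA_distr big_mkcond; apply: eq_bigr => P _.
case: ifPn => [sPX|/subsetPn[x Px Xx]]; last first.
  by rewrite (bigD1 x) //= Px /f (negbTE Xx) mul0r.
rewrite -big_mkcond /= -prodr_const; apply: eq_bigr => i Pi.
by rewrite /f (subsetP sPX).
Qed.

Section NoDilations.

Variables (F : finFieldType) (H : {set F}).
Hypothesis H_zmod : zmod_closed H.
Implicit Types (a z : F) (B : {set F}).

Let H'sf : is_subfield (Hprime H) := Hprime_subfield H_zmod.

(** [Hprime H] is a finite field. *)
Lemma Hprime_primitive_root :
  exists2 z, z \in Hprime H & (#|Hprime H| - 1).-primitive_root z.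
Proof.
have n0 : (0 < #|Hprime H| - 1)%N by rewrite subn_gt0 card_subfield_gt1.
have rs_unity : all (#|Hprime H| - 1).-unity_root (enum (Hprime H :\ 0)).
  apply/allP => x; rewrite mem_enum => /setD1P[x0 Hx].
  by rewrite unity_rootE subfield_expr_card.
have rs_size : (#|Hprime H| - 1 <= size (enum (Hprime H :\ 0%R)))%N.
  by rewrite -cardE (cardsD1 0 (Hprime H)) subfield0 // addKn.
have /hasP[z] := has_prim_root n0 rs_unity (enum_uniq _) rs_size.
by rewrite mem_enum => /setD1P[_ Hz] zP; exists z.
Qed.

Variable z : F.
Hypothesis z_prim : (#|Hprime H| - 1).-primitive_root z.

Let n := (#|Hprime H| - 1)%N.

Let n_gt0 : (0 < n)%N. Proof. exact: prim_order_gt0 z_prim. Qed.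

Variable B : {set F}.
Hypothesis B_transl : transl B = H.

(** These exponents are closed under remainders, so the least one divides the
    others. *)
Lemma stable_exponents : exists d, [/\ (0 < d)%N, (d %| n)%N
  & forall j, stable B (z ^+ j) 0 = (d %| j)%N].
Proof.
have ex : exists d, (0 < d)%N && stable B (z ^+ d) 0.
  by exists n; rewrite n_gt0 (prim_expr_order z_prim) stable_id.
case: (ex_minnP ex) => d /andP[d0 sd] dmin.
have z0 : z != 0 := primitive_root_neq0 z_prim.
have eqS j : stable B (z ^+ j) 0 = (d %| j)%N.
  apply/idP/idP => [sj|/dvdnP[i ->]]; last by rewrite mulnC exprM stableX.
  have sr : stable B (z ^+ (j %% d)) 0.
    have zd0 : z ^+ (j %/ d * d) != 0 by rewrite expf_neq0.
    have sm : stable B (z ^+ (j %/ d * d)) 0 by rewrite mulnC exprM stableX.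
    have := stable_comp sj (stable_inv zd0 sm); rewrite mulr0 oppr0 mulr0 addr0.
    by rewrite {1}(divn_eq j d) exprD mulrAC divff // mul1r.
  rewrite /dvdn; apply: contraTT (ltn_pmod j d0); rewrite -leqNgt -lt0n => j0.
  by apply: dmin; rewrite j0.
exists d; split=> //; by rewrite -eqS (prim_expr_order z_prim) stable_id.
Qed.

(** With [d] as in [stable_exponents], [z ^+ (n %/ e)] preserves [B] exactly
    when [e] divides [n %/ d], and a product of distinct primes divides a number
    as soon as each of them does. *)
Lemma stable_PiP (P : {set 'I_n.+1}) : P \subset prime_divs n ->
  stable B (z ^+ (n %/ PiP P)) 0 =
    (P \subset [set e : 'I_n.+1 | stable B (z ^+ (n %/ e)) 0]).
Proof.
move=> /subsetP sP; have [d [d0 dn eqS]] := stable_exponents.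
have swap x : (x %| n -> (d %| n %/ x) = (x %| n %/ d))%N.
  by move=> xn; rewrite !dvdn_divRL // mulnC.
have prP : {in P, forall e : 'I_n.+1, prime e}.
  by move=> e /sP; rewrite inE => /andP[].
have dvP : {in P, forall e : 'I_n.+1, e %| n}%N.
  by move=> e /sP; rewrite inE => /andP[].
rewrite eqS swap; last exact/PiP_dvd.
apply/PiP_dvd/subsetP => // h e Pe; have := h e Pe; rewrite ?inE eqS swap // dvP //.
Qed.

(** The ratios of the dilations with centre 0 that preserve [B] form a subgroup
    of the cyclic group generated by [z], and a nontrivial finite group has an
    element of prime order. *)
Lemma dilation_stable_prime :
  dilation_stable B 0 =
    (prime_divs n :&: [set e : 'I_n.+1 | stable B (z ^+ (n %/ e)) 0] != set0).
Proof.
have [d [d0 dn eqS]] := stable_exponents.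
have z0 : z != 0 := primitive_root_neq0 z_prim.
apply/existsP/set0Pn => [[a /and3P[a0 a1]]|[e]].
  rewrite mulr0 subr0 => sa.
  have an1 : a ^+ n = 1.
    by apply: subfield_expr_card => //; rewrite -B_transl (stable_Hprime a0 sa).
  have [i ai] := prim_rootP z_prim an1.
  have nd : (1 < n %/ d)%N.
    rewrite ltn_divRL // mul1n ltn_neqAle dvdn_leq // andbT.
    apply: contraNneq a1 => E; move: sa; rewrite ai eqS E.
    by rewrite -(prim_order_dvd z_prim).
  have en : (pdiv (n %/ d) %| n)%N := dvdn_trans (pdiv_dvd _) (dvdn_div dn).
  have ltn : (pdiv (n %/ d) < n.+1)%N by rewrite ltnS dvdn_leq.
  exists (Ordinal ltn); rewrite !inE /= pdiv_prime // en /= eqS.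
  by rewrite dvdn_divRL // mulnC -dvdn_divRL // pdiv_dvd.
rewrite !inE => /andP[/andP[pe en] se]; exists (z ^+ (n %/ e)).
rewrite expf_neq0 //= mulr0 subr0 se andbT -(prim_order_dvd z_prim) gtnNdvd //.
  by rewrite divn_gt0 ?prime_gt0 // dvdn_leq.
by rewrite ltn_Pdiv ?prime_gt1.
Qed.

(** Inclusion-exclusion over the prime orders of the dilations fixing [0]. *)
Lemma no_dilation_sum :
  (~~ dilation_stable B 0)%:R =
    \sum_(P : {set 'I_n.+1} | P \subset prime_divs n)
      (-1) ^+ #|P| * (stable B (z ^+ (n %/ PiP P)) 0)%:R :> rat.
Proof.
rewrite dilation_stable_prime negbK -sum_sign_subsets.
rewrite big_mkcond [RHS]big_mkcond /=; apply: eq_bigr => P _.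
rewrite subsetI; case sP: (P \subset prime_divs n); rewrite //= stable_PiP //.
by case: (P \subset _); rewrite ?mulr1 ?mulr0.
Qed.

End NoDilations.

(** * The affine group as a matrix group *)

Section AffineMatrices.

Variable F : finFieldType.
Implicit Types (a b c h x y : F) (H B : {set F}) (g : {'GL_2[F]}).

Lemma aff_mx00 a b : aff_mx a b 0 0 = a. Proof. by rewrite mxE. Qed.

Lemma aff_mx01 a b : aff_mx a b 0 1 = b. Proof. by rewrite mxE. Qed.

Lemma aff_mxM a b c d :
  aff_mx a b *m aff_mx c d = aff_mx (a * c) (a * d + b).
Proof.
apply/matrixP => i j; rewrite !mxE !big_ord_recl big_ord0 !mxE /=.
case: i => -[|[|//]] ?; case: j => -[|[|//]] ?;
  by rewrite ?mulr1 ?mul1r ?mul0r ?mulr0 ?addr0 ?add0r.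
Qed.

Lemma aff_mx1 : aff_mx 1 0 = 1%:M :> 'M[F]_2.
Proof.
by apply/matrixP => i j; rewrite !mxE; case: i => -[|[|//]] ?; case: j => -[|[|//]] ?.
Qed.

Lemma aff_mx_unit a b : a != 0 -> exists g, val g = aff_mx a b.
Proof.
move=> a0; have /mulmx1_unit[ug _] : aff_mx a b *m aff_mx a^-1 (- (a^-1 * b)) = 1%:M.
  by rewrite aff_mxM divff // mulrN mulVKf // addNr aff_mx1.
by exists (FinRing.Unit ug).
Qed.

Lemma AGL1_stabE g a b B : a != 0 -> val g = aff_mx a b ->
  (g \in AGL1_stab B) = stable B a b.
Proof.
move=> a0 gE; rewrite inE -stable_imset //.
have -> : g \in AGL1 F.
  by rewrite inE; apply/existsP; exists a; apply/existsP; exists b; rewrite a0 gE eqxx.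
congr (_ == _); apply: eq_imset => x.
by rewrite /aff_act gE aff_mx00 aff_mx01.
Qed.

Lemma HbarP H g : reflect (exists2 h, h \in H & val g = aff_mx 1 h) (g \in Hbar H).
Proof.
rewrite inE; apply: (iffP existsP) => [[h /andP[Hh /eqP]]|[h Hh ->]]; exists h => //.
by rewrite Hh eqxx.
Qed.

Lemma S_groupE H : zmod_closed H -> S_group 1 0 H = Hbar H :> {set _}.
Proof.
case=> H0 HB; have HD : {in H &, forall x y, x + y \in H}.
  by move=> x y Hx Hy; rewrite -[y]opprK HB // -sub0r HB.
rewrite /= (_ : _ :|: _ = Hbar H); last first.
  apply/setUidPr/subsetP => g; rewrite inE => /eqP gE.
  by apply/HbarP; exists 0.
apply: gen_set_id; apply/group_setP; split.
  by apply/HbarP; exists 0 => //=; rewrite aff_mx1.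
move=> g g' /HbarP[h Hh gE] /HbarP[h' Hh' gE']; apply/HbarP.
exists (h' + h); first exact: HD.
by have := aff_mxM 1 h 1 h'; rewrite !mul1r -gE -gE'.
Qed.

(** The stabilizer of [B] is [Hbar H] exactly when its translations are those by
    [H] and it contains nothing but translations; an affine map that is not a
    translation is a dilation about its fixed point. *)
Lemma AGL1_stab_eq_S_group H B : zmod_closed H ->
  (AGL1_stab B == S_group 1 0 H) =
    (transl B == H) && ~~ [exists c, dilation_stable B c].
Proof.
move=> Hz; rewrite S_groupE //; apply/eqP/andP => [E|[/eqP tB nd]].
  have mem a b : a != 0 -> stable B a b = (a == 1) && (b \in H).
    move=> a0; have [g gE] := aff_mx_unit b a0; rewrite -(AGL1_stabE B a0 gE) E.
    apply/HbarP/andP => [[h Hh]|[/eqP a1 Hb]]; last by exists b; rewrite // gE a1.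
    rewrite gE => e; have := congr1 (fun M : 'M_2 => M 0 0) e.
    have := congr1 (fun M : 'M_2 => M 0 1) e.
    by rewrite !aff_mx00 !aff_mx01 => -> ->.
  split; first by apply/eqP/setP => h; rewrite inE mem ?oner_neq0 // eqxx.
  apply/existsP => -[c /existsP[a /and3P[a0 a1]]].
  by rewrite mem // (negbTE a1).
apply/setP => g; apply/idP/HbarP => [sg|[h Hh gE]]; last first.
  by move: Hh; rewrite (AGL1_stabE _ (oner_neq0 _) gE) -tB inE.
have : g \in AGL1 F by move: sg; rewrite inE => /andP[].
rewrite inE => /existsP[a /existsP[b /andP[a0 /eqP gE]]].
move: sg; rewrite (AGL1_stabE B a0 gE) => sB.
have a1 : a = 1.
  apply/eqP; apply: contraNT nd => a1; apply/existsP; exists (b / (1 - a)).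
  exact: stable_dilation.
by exists b; rewrite -?tB ?inE -a1.
Qed.

End AffineMatrices.


(** * The counting formula *)

Theorem theorem4p2 (p alpha beta k : nat) (F : finFieldType) (H : {set F})
    (p_prime : prime p) (cardF : #|F| = (p ^ alpha)%N)
    (HS : (1, 0, H) \in calS F) (cardH : #|H| = (p ^ beta)%N)
    (le_kq : (k <= #|F|)%N) :
  (numN (S_group 1 0 H) k)%:R =
    (1 - p%:R ^+ (alpha - beta)) *
      (\sum_(0 <= l < (alpha - beta).+1)
         (-1) ^+ l * p%:R ^+ 'C(l, 2) * gauss_binom (alpha - beta) l p%:R *
         s_qk #|F| k 1 (p ^ (beta + l)))
    + p%:R ^+ (alpha - beta) *
      (\sum_(P : {set 'I_(#|Hprime H| - 1).+1}
             | P \subset prime_divs (#|Hprime H| - 1))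
         let o := mulord (PiP P) p in
         \sum_(0 <= l < ((alpha - beta) %/ o).+1)
           (-1) ^+ (#|P| + l) * p%:R ^+ (o * 'C(l, 2)) *
           gauss_binom ((alpha - beta) %/ o) l (p%:R ^+ o) *
           s_qk #|F| k (PiP P) (p ^ (beta + l * o)))
  :> rat.
Proof.
have p1 := prime_gt1 p_prime; have p0 := prime_gt0 p_prime.
have Hz : zmod_closed H.
  move: HS; rewrite inE => /and3P[_ Hsp _].
  exact: subspace_zmod (Fp_adjoin_subfield 1) Hsp.
have [z Hz' z_prim] := Hprime_primitive_root Hz.
set n := (#|Hprime H| - 1)%N in z_prim *.
have n_gt0 : (0 < n)%N := prim_order_gt0 z_prim.
have lebeta : (beta <= alpha)%N.
  by rewrite -(leq_exp2l _ _ p1) -cardF -cardH max_card.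
pose X := [set B : {set F} | (transl B == H) && (#|B| == k)].
pose Y := [set B in X | [exists c, dilation_stable B c]].
pose Z := [set B in X | dilation_stable B 0].
have numE : numN (S_group 1 0 H) k = (#|X| - #|Y|)%N.
  have sYX : Y \subset X by apply/subsetP => B; rewrite inE => /andP[].
  rewrite -(setIidPr sYX) -cardsD; apply: eq_card => B.
  by rewrite !inE AGL1_stab_eq_S_group // negb_and; case: (transl B == H);
     case: (#|B| == k); case: [exists c, _].
have leYX : (#|Y| <= #|X|)%N.
  by apply/subset_leq_card/subsetP => B; rewrite inE => /andP[].
have cYZ : (#|Y|%:R = p%:R ^+ (alpha - beta) * #|Z|%:R :> rat).
  have pb0 : (#|H|%:R : rat) != 0 by rewrite pnatr_eq0 -lt0n cardH expn_gt0 p0.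
  apply: (mulIf pb0); rewrite -natrM.
  have -> : (#|Y| * #|H| = #|F| * #|Z|)%N.
    rewrite [Y](_ : _ = [set B | [&& transl B == H, #|B| == k & [exists c, dilation_stable B c]]]).
      rewrite card_dilation_stable; congr (_ * _)%N; apply: eq_card => B.
      by rewrite !inE andbA.
    by apply/setP => B; rewrite !inE andbA.
  rewrite cardF cardH -{1}(subnK lebeta) expnD !natrM !natrX.
  by rewrite mulrAC.
(* The trivial ratio: [u = o = 1]. *)
have cX : #|X|%:R = \sum_(0 <= l < (alpha - beta).+1)
         (-1) ^+ l * p%:R ^+ 'C(l, 2) * gauss_binom (alpha - beta) l p%:R *
         s_qk #|F| k 1 (p ^ (beta + l)) :> rat.
  have one_prim : 1.-primitive_root (1 : F).
    by apply/andP; split=> //; apply/forallP => i; rewrite ord1 unity_rootE expr1n !eqxx.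
  have := card_exact_transl k p_prime cardF one_prim Hz _ cardH.
  have -> : mulord 1 p = 1%N.
    rewrite /mulord; case: ex_minnP => m /andP[m0 _] /(_ 1%N).
    by rewrite !modn1 eqxx implybT => /(_ isT) m1; apply/eqP; rewrite eqn_leq m1.
  rewrite subfield1 ?Hprime_subfield // => /(_ isT); rewrite /= divn1.
  under eq_bigr do rewrite mul1n expr1 muln1.
  move=> <-; congr (_ %:R); apply: eq_card => B.
  by rewrite !inE stable_id andbT.
have cZ : #|X|%:R - #|Z|%:R = \sum_(P : {set 'I_n.+1} | P \subset prime_divs n)
    (-1) ^+ #|P| *
    #|[set B | [&& transl B == H, #|B| == k & stable B (z ^+ (n %/ PiP P)) 0]]|%:R :> rat.
  have -> : #|X|%:R - #|Z|%:R = \sum_(B in X) (~~ dilation_stable B 0)%:R :> rat.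
    have sZX : Z \subset X by apply/subsetP => B; rewrite inE => /andP[].
    rewrite -natr_sum -natrB ?subset_leq_card //; congr (_ %:R).
    rewrite -{1}(setIidPr sZX) -cardsD -sum1_card big_mkcond [RHS]big_mkcond /=.
    apply: eq_bigr => B _; rewrite !inE.
    by case: (_ == H); case: (_ == k) => //=; case: (dilation_stable B 0).
  transitivity (\sum_(B in X) \sum_(P : {set 'I_n.+1} | P \subset prime_divs n)
      (-1) ^+ #|P| * (stable B (z ^+ (n %/ PiP P)) 0)%:R : rat).
    apply: eq_bigr => B; rewrite inE => /andP[/eqP tB _].
    exact: no_dilation_sum.
  rewrite exchange_big /=; apply: eq_bigr => P _; rewrite -mulr_sumr; congr (_ * _).
  rewrite -natr_sum; congr (_ %:R); rewrite -sum1_card big_mkcond [RHS]big_mkcond /=.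
  apply: eq_bigr => B _; rewrite !inE andbA.
  by case: (_ && _) => //=; case: (stable _ _ _).
rewrite numE natrB // cYZ -cX.
set S2 := \sum_(P | _) _.
suff -> : S2 = #|X|%:R - #|Z|%:R by ring.
rewrite cZ; apply: eq_bigr => P sP.
have Pn : (PiP P %| n)%N.
  apply/PiP_dvd => e /(subsetP sP); rewrite inE => /andP[] //.
have zu : (PiP P).-primitive_root (z ^+ (n %/ PiP P)) := dvdn_prim_root z_prim Pn.
rewrite (card_exact_transl k p_prime cardF zu Hz _ cardH); last first.
  by rewrite subfieldX // Hprime_subfield.
rewrite /= mulr_sumr; apply: eq_bigr => l _.
by rewrite exprD !mulrA.
Qed.
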